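(* Let $V\in C^2(\mathbb{R}^d)$ be of additive form, $V(x)=\sum_{j=1}^dV_j(x_j)$, have a Lipschitz continuous gradient, and satisfy $\langle x-y,\nabla V(x)-\nabla V(y)\rangle\ge\kappa|x-y|^2$ for all $x,y\in D=[-K,K]^d$ and some $\kappa>0$. Consider the discrete-time Markov chain on $\mathcal{K}_h$ with transition matrix $\pi$ and time step $\tau=1/\mathcal{T}$ (defined in the context), and let $\nu,\eta$ be two probability measures on $\mathcal{K}_h$. Then $$\mathcal{W}_2(\nu\pi^n,\eta\pi^n)\le e^{-\kappa n\tau}\,\mathcal{W}_2(\nu,\eta)+O(h^{1/2})\quad\text{for all }n\in\mathbb{N},$$ where $O(h^{1/2})$ denotes a term bounded by $Ch^{1/2}$ with $C$ independent of $h,n,\nu,\eta$. Moreover, suppose additionally that $\kappa_+(i,j)>0$ for all $j\in\{1,\dots,d\}$ and all $i\in\mathcal{K}_h$ with $i+he_j\in\mathcal{K}_h$, and $\kappa_-(i,j)>0$ for all $j\in\{1,\dots,d\}$ and all $i\in\mathcal{K}_h$ with $i-he_j\in\mathcal{K}_h$, where $$\kappa_\pm(i,j)=c(i,\pm_j)-c(i\pm he_j,\pm_j)-\sum_{\gamma\in G\setminus\{+_j,-_j\}}\max\{c(i\pm he_j,\gamma)-c(i,\gamma),0\},$$ and set $\kappa_1=\min\{\kappa_+(i,j)+\kappa_-(i+he_j,j):\ j=1,\dots,d,\ i,\,i+he_j\in\mathcal{K}_h\}$. Then for all $n\in\mathbb{N}$, $$\mathcal{W}_{\mathrm{d},1}(\nu\pi^n,\eta\pi^n)\le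 e^{-\kappa_1n\tau}\,\mathcal{W}_{\mathrm{d},1}(\nu,\eta)\quad\text{and}\quad \mathcal{W}_1(\nu\pi^n,\eta\pi^n)\le\sqrt{d}\,e^{-\kappa_1n\tau}\,\mathcal{W}_1(\nu,\eta).$$
   Context: Setting. Let $d\ge1$, $K>0$, $D=[-K,K]^d$, $h>0$ with $2K/h\in\mathbb{N}$, $\sigma>0$, and let $e_1,\dots,e_d$ be the standard basis of $\mathbb{R}^d$. The grid is $\mathcal{K}_h=\{i=(i_1,\dots,i_d): i_j=-K+hn_j-h/2,\ n_j\in\{1,\dots,2K/h\}\}$. Put $V^h(i)=h^{-d}\int_{[-h/2,h/2]^d}V(i+s)\,ds$. Let $G=\{+_1,-_1,\dots,+_d,-_d\}$ be the set of moves, where $\pm_j$ acts by $i\mapsto i\pm he_j$; write $\gamma i$ for the image of $i$ under $\gamma$. The rates are $c(i,\pm_j)=\frac{\sigma^2}{h^2}e^{-(V^h(i\pm he_j)-V^h(i))/(2\sigma^2)}$ if $i\pm he_j\in\mathcal{K}_h$ and $c(i,\pm_j)=0$ otherwise. Discrete-time chain: $\mathcal{T}=2\max_{i\in\mathcal{K}_h}\sum_{\gamma\in G}c(i,\gamma)$, $\tau=1/\mathcal{T}$, and $\pi$ is the transition matrix with $\pi(i,\gamma i)=c(i,\gamma)/\mathcal{T}$ for moves $\gamma$ with $\gamma i\in\mathcal{K}_h$, $\pi(i,i)=1-\sum_{\gamma\in G}c(i,\gamma)/\mathcal{T}$, and all other entries $0$; $\nu\pi^n$ is the law at step $n$ of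 the chain started from $\nu$. For $p\ge1$, $\mathcal{W}_p(\nu,\eta)=\inf_{\gamma\in\Gamma(\nu,\eta)}\big(\int|x-y|^p\,\gamma(dx\,dy)\big)^{1/p}$ with $|\cdot|$ the Euclidean norm and $\Gamma(\nu,\eta)$ the set of probability measures on $\mathcal{K}_h\times\mathcal{K}_h$ with marginals $\nu,\eta$. $\mathcal{W}_{\mathrm{d},1}(\nu,\eta)=\inf_{\gamma\in\Gamma(\nu,\eta)}\int\mathrm{d}(x,y)\,\gamma(dx\,dy)$ with the graph distance $\mathrm{d}(x,y)=\sum_{j=1}^d|x_j-y_j|$. *)

(* Defs.v *)
From HB Require Import structures.
From mathcomp Require Import all_boot all_order all_algebra.
From mathcomp Require Import all_classical all_reals all_analysis.

Set Implicit Arguments.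
Unset Strict Implicit.
Unset Printing Implicit Defensive.

Import Order.TTheory GRing.Theory Num.Theory.
Import numFieldNormedType.Exports.
Local Open Scope classical_set_scope.
Local Open Scope ring_scope.

Section Euclidean.
Context {R : realType} {d : nat}.

Definition basis_vec (j : 'I_d) : 'rV[R]_d := delta_mx 0 j.

Definition dotr (x y : 'rV[R]_d) : R := \sum_(j < d) x 0 j * y 0 j.

(* The library norm on ['rV[R]_d] is the sup norm. *)
Definition enorm (x : 'rV[R]_d) : R := Num.sqrt (\sum_(j < d) x 0 j ^+ 2).

Definition l1norm (x : 'rV[R]_d) : R := \sum_(j < d) `|x 0 j|.

Definition cube (K : R) : set 'rV[R]_d := [set x | forall j, - K <= x 0 j <= K].

Definition grad (V : 'rV[R]_d -> R) (x : 'rV[R]_d) : 'rV[R]_d :=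
  \row_j 'D_(basis_vec j) V x.

(* All partial derivatives of order at most 2 exist and are continuous. *)
Definition C2 (V : 'rV[R]_d -> R) : Prop :=
  [/\ continuous V,
      forall j, (forall x, derivable V x (basis_vec j)) /\
                continuous ('D_(basis_vec j) V : 'rV[R]_d -> R)
    & forall j k,
        (forall x, derivable ('D_(basis_vec j) V : 'rV[R]_d -> R) x (basis_vec k)) /\
        continuous ('D_(basis_vec k) ('D_(basis_vec j) V) : 'rV[R]_d -> R)].

Definition additive_form (V : 'rV[R]_d -> R) : Prop :=
  exists Vc : 'I_d -> R -> R, forall x, V x = \sum_(j < d) Vc j (x 0 j).

Definition lipschitz_grad (V : 'rV[R]_d -> R) : Prop :=
  exists L : R, forall x y,
    enorm (grad V x - grad V y) <= L * enorm (x - y).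

Definition strongly_convex_on (A : set 'rV[R]_d) (kappa : R)
    (V : 'rV[R]_d -> R) : Prop :=
  forall x y, A x -> A y ->
    kappa * enorm (x - y) ^+ 2 <= dotr (x - y) (grad V x - grad V y).

End Euclidean.

(* The integral of [f] over [[a, b]^d], as an iterated Lebesgue integral; for
   continuous [f] (the only use below) it is the [d]-dimensional Lebesgue
   integral by Fubini's theorem. *)
Fixpoint box_integral {R : realType} (a b : R) (d : nat) :
    ('rV[R]_d -> R) -> R :=
  match d with
  | 0 => fun f => f 0
  | d'.+1 => fun f =>
      Rintegral lebesgue_measure `[a, b]
        (fun t => box_integral a b (fun s : 'rV[R]_d' =>
           f (row_mx (const_mx t : 'rV[R]_1) s : 'rV[R]_(1 + d'))))
  end.

(* A grid point is represented by its indices; the index [m : 'I_N] stands for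
   [n_j = m + 1] in [1, N], where [N = 2K/h]. *)
Definition grid (d N : nat) := {ffun 'I_d -> 'I_N}.

(* The move [(j, true)] is [+_j] and [(j, false)] is [-_j]. *)
Definition move (d : nat) := ('I_d * bool)%type.

Section Chain.
Context {R : realType} {d N : nat}.
Implicit Types (K h sigma : R) (V : 'rV[R]_d -> R) (i k : grid d N).

Definition pos K h i : 'rV[R]_d := \row_j (- K + h * (i j).+1%:R - h / 2).

Definition shift h (g : move d) : 'rV[R]_d :=
  (if g.2 then h else - h) *: basis_vec g.1.

(* The grid point with position [pos i + shift g], or [None] if that position
   is not in the grid. *)
Definition move_to K h i (g : move d) : option (grid d N) :=
  [pick k | pos K h k == pos K h i + shift h g].

Definition Vh h V (x : 'rV[R]_d) : R :=
  h ^- d * box_integral (- (h / 2)) (h / 2) (fun s => V (x + s)).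

Definition rate K h sigma V i (g : move d) : R :=
  if move_to K h i g is Some k then
    sigma ^+ 2 / h ^+ 2 *
    expR (- (Vh h V (pos K h k) - Vh h V (pos K h i)) / (2 * sigma ^+ 2))
  else 0.

(* Rates are nonnegative, so the default value [0] does not affect the max. *)
Definition calT K h sigma V : R :=
  2 * \big[Num.max/0]_(i : grid d N) \sum_g rate K h sigma V i g.

Definition tau K h sigma V : R := (calT K h sigma V)^-1.

(* Distinct moves lead to distinct grid points, all different from [i], so the
   last sum has at most one term. *)
Definition trans K h sigma V i k : R :=
  if k == i then 1 - \sum_g rate K h sigma V i g / calT K h sigma V
  else \sum_(g | move_to K h i g == Some k)
         rate K h sigma V i g / calT K h sigma V.

Definition law K h sigma V (nu : grid d N -> R) (n : nat) : grid d N -> R :=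
  iter n (fun mu k => \sum_i mu i * trans K h sigma V i k) nu.

(* [kappa_pm true i j] is [kappa_+(i,j)] and [kappa_pm false i j] is
   [kappa_-(i,j)]; only meaningful when the move [(j, s)] from [i] stays in the
   grid. *)
Definition kappa_pm K h sigma V (s : bool) i (j : 'I_d) : R :=
  if move_to K h i (j, s) is Some k then
    rate K h sigma V i (j, s) - rate K h sigma V k (j, s)
    - \sum_(g : move d | g \notin [:: (j, true); (j, false)])
        Num.max (rate K h sigma V k g - rate K h sigma V i g) 0
  else 0.

(* A minimum: the set is finite, and nonempty if [0 < d] and [1 < N]. *)
Definition kappa1 K h sigma V : R :=
  inf [set r | exists (j : 'I_d) (i k : grid d N),
         move_to K h i (j, true) = Some k /\
         r = kappa_pm K h sigma V true i j + kappa_pm K h sigma V false k j].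

End Chain.

(* Probability measures on a finite set, given by their mass functions. *)
Definition is_prob {R : realType} {T : finType} (nu : T -> R) : Prop :=
  (forall x, 0 <= nu x) /\ \sum_x nu x = 1.

Definition couplings {R : realType} {T : finType} (nu eta : T -> R) :
    set (T * T -> R) :=
  [set gam | [/\ is_prob gam,
     forall x, \sum_y gam (x, y) = nu x
   & forall y, \sum_x gam (x, y) = eta y]].

Definition wass {R : realType} {d N : nat} (K h p : R)
    (nu eta : grid d N -> R) : R :=
  inf [set (\sum_(z : grid d N * grid d N)
              enorm (pos K h z.1 - pos K h z.2) `^ p * gam z) `^ p^-1
      | gam in couplings nu eta].

Definition wass_d1 {R : realType} {d N : nat} (K h : R)
    (nu eta : grid d N -> R) : R :=
  inf [set \sum_(z : grid d N * grid d N)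
              l1norm (pos K h z.1 - pos K h z.2) * gam z
      | gam in couplings nu eta].

Arguments calT {R d} N K h sigma V.
Arguments tau {R d} N K h sigma V.
Arguments kappa1 {R d} N K h sigma V.

(* Main.v *)
(* The chain is coupled with itself by letting both copies make each move
   together at the smaller of their two rates, the excess rate moving one copy
   alone. As [V] is additive, the rates in direction [j] depend only on the
   [j]-th coordinate; they are monotone in it, because [V] is convex or because
   [kappa_+] and [kappa_-] are positive, so every lone move shrinks the gap
   between the two copies in that coordinate. For the graph distance, the rate
   of decrease is a telescoping sum of terms [kappa_+ + kappa_-]. For the
   squared Euclidean distance, strong convexity bounds the excess rates over a
   gap of [r] cells below by [kappa r (1 - O(h))], also at the boundary, where a
   vanishing rate is smaller than the rate continued by convexity; the one-step
   error is then [O(h tau)], and summing the geometric series gives an [O(h)]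
   error on the squared distance. *)

Require Import Defs.
From HB Require Import structures.
From mathcomp Require Import all_boot all_order all_algebra.
From mathcomp Require Import all_classical all_reals all_analysis.
From mathcomp Require Import zify ring lra.
Set Implicit Arguments.
Unset Strict Implicit.
Unset Printing Implicit Defensive.
Import Order.TTheory GRing.Theory Num.Theory.
Import numFieldNormedType.Exports.
Local Open Scope classical_set_scope.
Local Open Scope ring_scope.

(** * Couplings of mass functions on a finite set *)

Lemma sum_pair {R : realType} {S T : finType} (F : S * T -> R) :
  \sum_z F z = \sum_a \sum_b F (a, b).
Proof. by rewrite pair_bigA; apply: eq_bigr => -[]. Qed.

Section Couplings.
Context {R : realType} {S : finType}.
Implicit Types (nu eta : S -> R) (gam : S * S -> R).

Lemma sum_indicator (F : S -> R) (a : S) :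
  \sum_b F b * (b == a)%:R = F a.
Proof.
rewrite (bigD1 a) //= eqxx mulr1 big1 ?addr0 // => b /negPf ->.
by rewrite mulr0.
Qed.

Lemma sum_fst gam (x : S) :
  \sum_y gam (x, y) = \sum_z (z.1 == x)%:R * gam z.
Proof.
rewrite sum_pair /=.
rewrite [RHS](bigD1 x) //= [X in _ + X]big1 ?addr0 => [|a /negPf ->].
  by apply: eq_bigr => y _; rewrite eqxx mul1r.
by apply: big1 => b _; rewrite mul0r.
Qed.

Lemma sum_snd gam (y : S) :
  \sum_x gam (x, y) = \sum_z (z.2 == y)%:R * gam z.
Proof.
rewrite sum_pair /=.
apply: eq_bigr => a _; rewrite (bigD1 y) //= eqxx mul1r big1 ?addr0 //.
by move=> b /negPf ->; rewrite mul0r.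
Qed.

Lemma product_coupling nu eta : is_prob nu -> is_prob eta ->
  couplings nu eta (fun z => nu z.1 * eta z.2).
Proof.
move=> [nu0 nu1] [eta0 eta1]; split=> [|x|y].
- split=> [z|]; first exact: mulr_ge0.
  rewrite sum_pair /= -[RHS]nu1.
  by apply: eq_bigr => a _; rewrite -mulr_sumr eta1 mulr1.
- by rewrite /= -mulr_sumr eta1 mulr1.
- by rewrite /= -mulr_suml nu1 mul1r.
Qed.

Lemma couplings_nonempty nu eta : is_prob nu -> is_prob eta ->
  couplings nu eta !=set0.
Proof. by move=> hnu heta; eexists; exact: product_coupling. Qed.

End Couplings.

(** * Jump chains and their joint evolution *)

Section JumpChain.
Context {R : realType} {S G : finType}.
Variables (mv : S -> G -> S) (c : S -> G -> R) (t : R).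

Definition jump (x x' : S) : R :=
  \sum_g t * c x g * (x' == mv x g)%:R
  + (1 - \sum_g t * c x g) * (x' == x)%:R.

Definition common (z : S * S) (g : G) : R := Num.min (c z.1 g) (c z.2 g).

(** In each direction the joint move and the two lone moves have total rate
    [c z.1 g + c z.2 g - common z g], the larger of the two rates; the remaining mass stays at
    [z]. *)
Definition joint_jump (z z' : S * S) : R :=
  \sum_g t * (common z g * (z' == (mv z.1 g, mv z.2 g))%:R
              + (c z.1 g - common z g) * (z' == (mv z.1 g, z.2))%:R
              + (c z.2 g - common z g) * (z' == (z.1, mv z.2 g))%:R)
  + (1 - \sum_g t * (c z.1 g + c z.2 g - common z g)) * (z' == z)%:R.

(** This is the generator form of the kernel. Marginals, total mass and drift are all read off from
    it by choosing [f]: an indicator, the constant 1, or a cost. *)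
Lemma joint_jump_mean (f : S * S -> R) (z : S * S) :
  \sum_z' f z' * joint_jump z z' =
  f z + t * \sum_g (common z g * (f (mv z.1 g, mv z.2 g) - f z)
              + (c z.1 g - common z g) * (f (mv z.1 g, z.2) - f z)
              + (c z.2 g - common z g) * (f (z.1, mv z.2 g) - f z)).
Proof.
under eq_bigr => z' _ do rewrite mulrDr [X in _ + X]mulrCA mulr_sumr.
rewrite big_split /= exchange_big /= -mulr_sumr sum_indicator.
rewrite mulrBl mul1r addrCA; congr (_ + _).
rewrite mulr_suml -sumrB mulr_sumr; apply: eq_bigr => g _.
under eq_bigr => z' _ do
  rewrite mulrCA !mulrDr ![f z' * (_ * _)]mulrCA.
rewrite !big_split /= -!mulr_sumr !sum_indicator; ring.
Qed.

Lemma jump_mean (f : S -> R) (x : S) :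
  \sum_x' f x' * jump x x' = f x + t * \sum_g c x g * (f (mv x g) - f x).
Proof.
under eq_bigr => z' _ do rewrite mulrDr [X in _ + X]mulrCA mulr_sumr.
rewrite big_split /= exchange_big /= -mulr_sumr sum_indicator.
rewrite mulrBl mul1r addrCA; congr (_ + _).
rewrite mulr_suml -sumrB mulr_sumr; apply: eq_bigr => g _.
under eq_bigr => z' _ do rewrite mulrCA.
by rewrite -mulr_sumr sum_indicator; ring.
Qed.

Lemma jump_indicator (x x' : S) :
  jump x x' = (x == x')%:R
    + t * \sum_g c x g * ((mv x g == x')%:R - (x == x')%:R).
Proof.
rewrite -(jump_mean (fun y => (y == x')%:R)) -[LHS](sum_indicator (jump x)).
by apply: eq_bigr => y _; rewrite mulrC.
Qed.

(** For the indicator of [x'] in the first copy, lone moves of the second copy contribute nothing,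
    and the common rate plus the excess restores [c z.1 g]. *)
Lemma joint_jump_fst (z : S * S) (x' : S) :
  \sum_y joint_jump z (x', y) = jump z.1 x'.
Proof.
rewrite sum_fst (joint_jump_mean (fun z => (z.1 == x')%:R)) jump_indicator /=.
by congr (_ + _ * _); apply: eq_bigr => g _; ring.
Qed.

Lemma joint_jump_snd (z : S * S) (y' : S) :
  \sum_x joint_jump z (x, y') = jump z.2 y'.
Proof.
rewrite sum_snd (joint_jump_mean (fun z => (z.2 == y')%:R)) jump_indicator /=.
by congr (_ + _ * _); apply: eq_bigr => g _; ring.
Qed.

Hypothesis c_ge0 : forall x g, 0 <= c x g.
Hypothesis t_ge0 : 0 <= t.
Hypothesis ct_le : forall x, t * \sum_g c x g <= 2^-1.

Lemma common_ge0 z g : 0 <= common z g.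
Proof. by rewrite /common le_min !c_ge0. Qed.

Lemma common_le1 z g : common z g <= c z.1 g.
Proof. by rewrite /common ge_min lexx. Qed.

Lemma common_le2 z g : common z g <= c z.2 g.
Proof. by rewrite /common ge_min lexx orbT. Qed.

(** The joint jump probability is at most the sum of those of the two copies. Each is at most one
    half by [ct_le], so the staying mass is nonnegative. *)
Lemma joint_jump_ge0 z z' : 0 <= joint_jump z z'.
Proof.
apply: addr_ge0.
  apply: sumr_ge0 => g _; apply: mulr_ge0 => //.
  by rewrite !addr_ge0 ?mulr_ge0 ?subr_ge0 ?common_ge0 ?common_le1 ?common_le2.
apply: mulr_ge0 => //; rewrite subr_ge0.
apply: (@le_trans _ _ (t * \sum_g c z.1 g + t * \sum_g c z.2 g)); last first.
  by have := ct_le z.1; have := ct_le z.2; lra.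
rewrite -mulrDr -big_split mulr_sumr; apply: ler_sum => g _.
by rewrite ler_wpM2l //= gerBl common_ge0.
Qed.

Lemma joint_jump_coupling nu eta gam : couplings nu eta gam ->
  couplings (fun k => \sum_i nu i * jump i k) (fun k => \sum_i eta i * jump i k)
            (fun z' => \sum_z gam z * joint_jump z z').
Proof.
move=> [[gam0 gam1] gamx gamy]; split=> [|x'|y'].
- split=> [z'|].
    by apply: sumr_ge0 => z _; rewrite mulr_ge0 // joint_jump_ge0.
  rewrite exchange_big /= -[RHS]gam1; apply: eq_bigr => z _.
  rewrite -mulr_sumr.
  under eq_bigr => z' _ do rewrite -[joint_jump z z']mul1r.
  rewrite (joint_jump_mean (fun=> 1)) big1 ?mulr0 ?addr0 ?mulr1 // => g _.
  by rewrite subrr !mulr0 !addr0.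
- rewrite exchange_big /=.
  under eq_bigr => z _ do rewrite -mulr_sumr joint_jump_fst.
  rewrite sum_pair /=.
  by apply: eq_bigr => a _; rewrite -mulr_suml gamx.
- rewrite exchange_big /=.
  under eq_bigr => z _ do rewrite -mulr_sumr joint_jump_snd.
  rewrite sum_pair /=.
  by rewrite exchange_big; apply: eq_bigr => b _; rewrite -mulr_suml gamy.
Qed.

(** [B] is the fixed point of the affine recursion [u -> rho * u + (1 - rho) * B]. Writing the error
    this way sums the geometric series in closed form and keeps the induction linear. *)
Lemma iter_jump_coupling (f : S * S -> R) (rho B : R) : 0 <= rho ->
  (forall z, \sum_z' f z' * joint_jump z z' <= rho * f z + (1 - rho) * B) ->
  forall nu eta gam n, couplings nu eta gam ->
  exists2 gam', couplings
      (iter n (fun mu k => \sum_i mu i * jump i k) nu)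
      (iter n (fun mu k => \sum_i mu i * jump i k) eta) gam'
    & \sum_z f z * gam' z <=
      rho ^+ n * (\sum_z f z * gam z) + (1 - rho ^+ n) * B.
Proof.
move=> rho0 fP nu eta gam n gamP; elim: n => [|n [gam' gam'P IH]].
  by exists gam; rewrite // expr0 mul1r subrr mul0r addr0.
eexists; first exact: joint_jump_coupling gam'P.
have -> : \sum_z f z * (\sum_z0 gam' z0 * joint_jump z0 z) =
    \sum_z0 gam' z0 * \sum_z f z * joint_jump z0 z.
  under eq_bigr => z _ do rewrite mulr_sumr.
  rewrite exchange_big; apply: eq_bigr => z0 _.
  by rewrite mulr_sumr; apply: eq_bigr => z _; rewrite mulrCA.
case: gam'P => [[gam'0 gam'1] _ _].
apply: (@le_trans _ _ (\sum_z gam' z * (rho * f z + (1 - rho) * B))).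
  by apply: ler_sum => z _; rewrite ler_wpM2l.
under eq_bigr => z _ do rewrite mulrDr.
rewrite big_split /= -mulr_suml gam'1 mul1r.
under eq_bigr => z _ do rewrite mulrCA [gam' z * _]mulrC.
rewrite -mulr_sumr.
have := ler_wpM2l rho0 IH; rewrite exprS; lra.
Qed.

End JumpChain.

(* Index reached from [m] by a move of sign [s]; [m.-1] truncates at [0]. *)
Definition neighbor (s : bool) (m : nat) : nat := if s then m.+1 else m.-1.

Definition in_range (N : nat) (s : bool) (m : nat) : bool :=
  if s then (m.+1 < N)%N else (0 < m)%N.

Definition gap (a b : nat) : nat := (a - b + (b - a))%N.

Lemma gapC a b : gap a b = gap b a.
Proof. by rewrite /gap addnC. Qed.

Lemma gapnn a : gap a a = 0%N.
Proof. by rewrite /gap; lia. Qed.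

(** * Moves on the grid in terms of indices *)

Section Moves.
Context {R : realType} {d N : nat}.
Variables (K h : R).
Hypothesis h_gt0 : 0 < h.
Implicit Types (i k : grid d N) (j l : 'I_d) (s : bool).

(** As [h] is nonzero, positions determine indices, so the real equation reduces to one on naturals;
    [in_range] rules out the truncated predecessor of 0. *)
Lemma pos_shift_eq i k j s :
  (pos K h k == pos K h i + Defs.shift h (j, s)) =
  [&& in_range N s (i j), (k j == neighbor s (i j) :> nat)
    & [forall l, (l != j) ==> (k l == i l)]].
Proof.
have h0 : h != 0 by rewrite gt_eqF.
have hn (a b : nat) : h * a.+1%:R = h * b.+1%:R -> a = b.
  by move=> /(mulfI h0)/eqP; rewrite eqr_nat => /eqP [].
apply/eqP/and3P => [/rowP ik|[r /eqP kj /forallP kl]].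
  have kl l : l != j -> k l = i l.
    move=> lj; have := ik l; rewrite !mxE (negPf lj) /= mulr0 addr0.
    by move=> /addIr/addrI/hn/val_inj.
  have kj : (if s then k j = (i j).+1 :> nat else i j = (k j).+1 :> nat).
    have := ik j; rewrite !mxE !eqxx mulr1 /=.
    case: s {ik} => e; apply: hn; rewrite -[in RHS]natr1; lra.
  split.
  - by case: s kj {ik} => /= [<-|->].
  - by case: s kj {ik} => /= ->.
  - by apply/forallP => l; apply/implyP => lj; apply/eqP/kl.
apply/rowP => l; rewrite !mxE /=.
have [->|lj] := eqVneq l j; last first.
  by have := kl l; rewrite lj => /eqP ->; rewrite mulr0 addr0.
rewrite kj; case: s r {kj} => /= r; first by rewrite -[in LHS]natr1 /=; ring.
by rewrite prednK // -[X in _ = _ + h * X - _ + _]natr1 /=; ring.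
Qed.

Lemma move_toP i k j s :
  reflect [/\ in_range N s (i j), k j = neighbor s (i j) :> nat
            & forall l, l != j -> k l = i l]
          (move_to K h i (j, s) == Some k).
Proof.
have E k' : reflect [/\ in_range N s (i j), k' j = neighbor s (i j) :> nat
            & forall l, l != j -> k' l = i l]
          (pos K h k' == pos K h i + Defs.shift h (j, s)).
  rewrite pos_shift_eq; apply: (iffP and3P) => -[r e kl]; split => //.
  - exact/eqP.
  - by move=> l lj; have /forallP /(_ l) := kl; rewrite lj => /eqP.
  - exact/eqP.
  - by apply/forallP => l; apply/implyP => lj; apply/eqP/kl.
rewrite /move_to; case: pickP => [k' /E [r e kl]|none]; last first.
  by apply: (iffP idP) => // /E; rewrite none.
apply: (iffP eqP) => [[<-]//|[_ e' kl']]; congr Some; apply/ffunP => l.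
have [->|lj] := eqVneq l j; first by apply: val_inj; rewrite /= e e'.
by rewrite kl ?kl'.
Qed.

Lemma move_to_some i j s : in_range N s (i j) ->
  exists k, move_to K h i (j, s) = Some k.
Proof.
move=> r; have mN : (neighbor s (i j) < N)%N.
  by have := ltn_ord (i j); case: s r => /=; lia.
exists [ffun l => if l == j then Ordinal mN else i l].
apply/eqP/move_toP; split=> [//||l lj]; first by rewrite ffunE eqxx.
by rewrite ffunE (negPf lj).
Qed.

Lemma move_to_in_range i j s : move_to K h i (j, s) = in_range N s (i j) :> bool.
Proof.
apply/idP/idP => [|/move_to_some [k ->] //].
by case e: (move_to K h i (j, s)) => [k|//] _; case/eqP/move_toP: e.
Qed.

(** Total version of [move_to]. A move that leaves the grid fixes [i], which is harmless because its
    rate is 0. *)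
Definition apply_move i (g : move d) : grid d N := odflt i (move_to K h i g).

Lemma move_to_reverse i k j s :
  move_to K h i (j, s) = Some k -> move_to K h k (j, ~~ s) = Some i.
Proof.
move=> /eqP/move_toP [r e kl]; apply/eqP/move_toP; split.
- by have := ltn_ord (i j); rewrite e; case: s r {e} => /=; lia.
- by rewrite e; case: s r {e} => //= r; rewrite prednK.
- by move=> l lj; rewrite kl.
Qed.

End Moves.

(** * One-step drift of separable costs *)

Section Contraction.
Context {R : realType} {d N : nat}.

(* Only the larger of two coordinates can decrease alone, and only the smaller
   one can increase alone: every excess rate shrinks the gap. *)
Lemma local_drift (q : bool -> nat -> R) (g : nat -> R) (lam e : R) :
  g 0%N = 0 -> 0 <= e ->
  (forall l m, (l < m < N)%N ->
     [/\ q true m <= q true l, q false l <= q false m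
       & (q true l - q true m + (q false m - q false l)) *
         (g (m - l).-1 - g (m - l)%N) <= e - lam * g (m - l)%N]) ->
  forall a b, (a < N)%N -> (b < N)%N ->
  \sum_s ((q s a - Num.min (q s a) (q s b)) *
            (g (gap (neighbor s a) b) - g (gap a b))
          + (q s b - Num.min (q s a) (q s b)) *
            (g (gap a (neighbor s b)) - g (gap a b)))
  <= e - lam * g (gap a b).
Proof.
move=> g0 e0 qP a b; rewrite big_bool /=.
(* The drift is symmetric in the two copies, because [gap] and [Num.min] are. *)
wlog ab : a b / (b <= a)%N.
  move=> H aN bN; have [|] := leqP b a; first by move=> ba; exact: H.
  move=> /ltnW /H /(_ bN aN); rewrite ![gap b _]gapC ![gap _ a]gapC.
  rewrite ![Num.min (q _ b) _]minC; lra.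
move=> aN bN; case: ltngtP ab => // [ba _|<- _]; last first.
  by rewrite !minxx gapnn g0 !subrr !mul0r mulr0; lra.
have [|qt qf] := qP b a; first by rewrite ba.
rewrite (min_idPl qt) (min_idPr qf) !subrr !mul0r add0r addr0.
have -> : gap a b = (a - b)%N by rewrite /gap; lia.
have -> : gap a b.+1 = (a - b).-1 by rewrite /gap; lia.
have -> : gap a.-1 b = (a - b).-1 by rewrite /gap; lia.
by rewrite mulrDl.
Qed.

Variables (K h : R) (q : 'I_d -> bool -> nat -> R).
Hypothesis h_gt0 : 0 < h.
Hypothesis q_ge0 : forall j s m, 0 <= q j s m.
Hypothesis q_out : forall j s m, ~~ in_range N s m -> q j s m = 0.

Let c (i : grid d N) (g : move d) : R := q g.1 g.2 (i g.1).

(** One family for both metrics: [g r = h * r] gives the graph distance and [g r = (h * r) ^ 2] the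
    squared Euclidean distance. *)
Definition grid_cost (g : nat -> R) (z : grid d N * grid d N) : R :=
  \sum_j g (gap (z.1 j) (z.2 j)).

Lemma grid_cost_update g (x y x' y' : grid d N) (j : 'I_d) :
  (forall l, l != j -> x' l = x l) -> (forall l, l != j -> y' l = y l) ->
  grid_cost g (x', y') - grid_cost g (x, y) =
  g (gap (x' j) (y' j)) - g (gap (x j) (y j)).
Proof.
move=> xl yl; rewrite /grid_cost -sumrB (bigD1 j) //= big1 ?addr0 // => l lj.
by rewrite xl ?yl // subrr.
Qed.

Lemma apply_moveP (x : grid d N) j s : in_range N s (x j) ->
  apply_move K h x (j, s) j = neighbor s (x j) :> nat /\
  forall l, l != j -> apply_move K h x (j, s) l = x l.
Proof.
move=> r; rewrite /apply_move; have [k e] := move_to_some K h_gt0 r.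
by rewrite e; case/eqP/move_toP: e.
Qed.

(** A move changes one coordinate, hence one term of a separable cost. The drift therefore splits
    over the coordinates, and [local_drift] applies to each; the errors [e] add up to [d%:R * e]. *)
Lemma grid_cost_contraction (g : nat -> R) (t lam e : R) :
  0 <= t -> g 0%N = 0 -> 0 <= e ->
  (forall j l m, (l < m < N)%N ->
     [/\ q j true m <= q j true l, q j false l <= q j false m
       & (q j true l - q j true m + (q j false m - q j false l)) *
         (g (m - l).-1 - g (m - l)%N) <= e - lam * g (m - l)%N]) ->
  forall z, \sum_z' grid_cost g z' * joint_jump (apply_move K h) c t z z' <=
    (1 - lam * t) * grid_cost g z + t * (d%:R * e).
Proof.
move=> t0 g0 e0 qP [x y]; rewrite joint_jump_mean.
suff : \sum_(m : move d) (common c (x, y) m *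
    (grid_cost g (apply_move K h x m, apply_move K h y m) - grid_cost g (x, y))
    + (c x m - common c (x, y) m) *
      (grid_cost g (apply_move K h x m, y) - grid_cost g (x, y))
    + (c y m - common c (x, y) m) *
      (grid_cost g (x, apply_move K h y m) - grid_cost g (x, y)))
    <= d%:R * e - lam * grid_cost g (x, y).
  by move=> /(ler_wpM2l t0) /=; lra.
rewrite sum_pair /grid_cost /= mulr_sumr.
rewrite -[X in X%:R * e]card_ord mulr_natl -sumr_const -sumrB.
apply: ler_sum => j _.
apply: le_trans (local_drift g0 e0 (qP j) (ltn_ord (x j)) (ltn_ord (y j))).
rewrite le_eqVlt; apply/orP; left; apply/eqP/eq_bigr => s _.
rewrite -/(grid_cost g (x, y)).
have out (i i' : grid d N) : ~~ in_range N s (i j) -> common c (i, i') (j, s) = 0.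
  by move=> r; rewrite /common /c /= (q_out _ r) (min_idPl _).
have outr (i i' : grid d N) : ~~ in_range N s (i' j) -> common c (i, i') (j, s) = 0.
  by move=> r; rewrite /common /c /= (q_out _ r) (min_idPr _).
(* Joint moves preserve every gap. If one copy cannot make the move, its rate is 0 and so is the
   common rate. *)
rewrite [X in X + _ + _](_ : _ = 0) ?add0r; last first.
  have [rx|/out ->] := boolP (in_range N s (x j)); last by rewrite mul0r.
  have [ry|/outr ->] := boolP (in_range N s (y j)); last by rewrite mul0r.
  have [[ex xl] [ey yl]] := (apply_moveP rx, apply_moveP ry).
  apply/eqP; rewrite mulf_eq0; apply/orP; right.
  rewrite (grid_cost_update g xl yl) ex ey subr_eq0; apply/eqP; congr (g _).
  by rewrite /gap; case: s rx ry {out outr ex xl ey yl} => /=; lia.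
(* For the lone moves, the rate of an impossible move is 0, hence so is its excess. *)
congr (_ + _).
  have [rx|rx] := boolP (in_range N s (x j)); last first.
    by rewrite /common /c /= [q j s (x j)]q_out // (min_idPl _) // subr0 !mul0r.
  have [ex xl] := apply_moveP rx.
  by rewrite (grid_cost_update g xl (fun _ _ => erefl)) ex.
have [ry|ry] := boolP (in_range N s (y j)); last first.
  by rewrite /common /c /= [q j s (y j)]q_out // (min_idPr _) // subr0 !mul0r.
have [ey yl] := apply_moveP ry.
by rewrite (grid_cost_update g (fun _ _ => erefl) yl) ey.
Qed.

End Contraction.

(** * The chain of the theorem as a jump chain *)

Section Law.
Context {R : realType} {d N : nat}.
Variables (K h sigma : R) (V : 'rV[R]_d -> R).
Hypothesis h_gt0 : 0 < h.
Let c : grid d N -> move d -> R := rate K h sigma V.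
Let T : R := calT N K h sigma V.
Let t : R := tau N K h sigma V.

Lemma rate_ge0 i g : 0 <= c i g.
Proof.
rewrite /c /rate; case: move_to => // k.
by rewrite mulr_ge0 ?expR_ge0 // divr_ge0 ?sqr_ge0.
Qed.

Lemma calT_ge (i : grid d N) : 2 * \sum_g c i g <= T.
Proof. by rewrite ler_pM2l ?ltr0n //; exact: le_bigmax. Qed.

Lemma tau_ge0 : 0 <= t.
Proof.
rewrite /t /tau invr_ge0 mulr_ge0 //.
elim/big_ind: _ => // [x y x0 y0|i _]; first by rewrite le_max x0.
by apply: sumr_ge0 => g _; exact: rate_ge0.
Qed.

Lemma tau_rate_le (i : grid d N) : t * \sum_g c i g <= 2^-1.
Proof.
have := calT_ge i; rewrite /t /tau -/T => H.
(* If all rates vanish, then [T = 0] and the convention [0^-1 = 0] makes [t] zero. *)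
have [->|T0] := eqVneq T 0; first by rewrite invr0 mul0r invr_ge0.
have Tp : 0 < T by rewrite lt_neqAle eq_sym T0 -[_ <= _]invr_ge0 tau_ge0.
by rewrite mulrC ler_pdivrMr //; lra.
Qed.

(** The two kernels differ in form only on the diagonal, where [jump] also counts moves that fix
    [i]. These are the moves leaving the grid, whose rate is 0. *)
Lemma trans_jump (i k : grid d N) :
  trans K h sigma V i k = jump (apply_move K h) c t i k.
Proof.
have tE g : rate K h sigma V i g / calT N K h sigma V = t * c i g.
  by rewrite mulrC.
rewrite /trans /jump; under eq_bigr => g _ do rewrite tE.
have [->|ki] := eqVneq k i.
  rewrite mulr1 [X in _ = X + _]big1 ?add0r // => -[j s] _.
  have -> : c i (j, s) = if move_to K h i (j, s) is Some k' then c i (j, s) else 0.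
    by rewrite /c /rate; case: move_to.
  case e: (move_to K h i (j, s)) => [k'|]; last by rewrite mulr0 mul0r.
  rewrite /apply_move e /=; case/eqP/(move_toP _ h_gt0): e => r kj _.
  have [E|_] := eqVneq i k'; last by rewrite mulr0.
  by move: kj; rewrite -E; case: s r => /=; lia.
rewrite mulr0 addr0 big_mkcond; apply: eq_bigr => g _; rewrite tE.
rewrite /apply_move /c /rate; case: move_to => [k'|] /=; last by rewrite mulr0 mul0r.
by rewrite (inj_eq Some_inj) eq_sym; case: eqVneq; rewrite ?mulr1 ?mulr0.
Qed.

Lemma law_coupling (f : grid d N * grid d N -> R) (rho B : R) : 0 <= rho ->
  (forall z, \sum_z' f z' * joint_jump (apply_move K h) c t z z' <=
             rho * f z + (1 - rho) * B) ->
  forall nu eta gam n, couplings nu eta gam ->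
  exists2 gam', couplings (law K h sigma V nu n) (law K h sigma V eta n) gam'
    & \sum_z f z * gam' z <=
      rho ^+ n * (\sum_z f z * gam z) + (1 - rho ^+ n) * B.
Proof.
move=> rho0 fP nu eta gam n gamP.
have lawE mu : law K h sigma V mu n =
    iter n (fun mu k => \sum_i mu i * jump (apply_move K h) c t i k) mu.
  rewrite /law; congr (iter n _ mu); apply/funext => mu'; apply/funext => k.
  by apply: eq_bigr => i _; rewrite trans_jump.
rewrite !lawE; apply: iter_jump_coupling gamP => //.
- exact: rate_ge0.
- exact: tau_ge0.
- exact: tau_rate_le.
Qed.

End Law.

(** * Transport costs and comparison of infima *)

Section Wasserstein.
Context {R : realType} {d N : nat}.
Variables (K h : R).
Hypothesis h_gt0 : 0 < h.
Implicit Types (z : grid d N * grid d N) (nu eta : grid d N -> R).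

Lemma pos_gap z j :
  `|(pos K h z.1 - pos K h z.2) 0 j| = h * (gap (z.1 j) (z.2 j))%:R.
Proof.
rewrite !mxE; set a := z.1 j; set b := z.2 j.
have -> : - K + h * a.+1%:R - h / 2 - (- K + h * b.+1%:R - h / 2) =
  h * (a%:R - b%:R) by rewrite -!natr1; ring.
rewrite normrM gtr0_norm //; congr (_ * _).
wlog ab : a b / (b <= a)%N.
  by move=> H; have [/H //|/ltnW /H e] := leqP b a; rewrite distrC gapC.
have -> : gap a b = (a - b)%N by rewrite /gap; lia.
by rewrite natrB // ger0_norm // subr_ge0 ler_nat.
Qed.

Lemma l1norm_grid_cost z :
  l1norm (pos K h z.1 - pos K h z.2) = grid_cost (fun r => h * r%:R) z.
Proof. by apply: eq_bigr => j _; rewrite pos_gap. Qed.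

Lemma enorm_grid_cost z :
  enorm (pos K h z.1 - pos K h z.2) ^+ 2 = grid_cost (fun r => (h * r%:R) ^+ 2) z.
Proof.
rewrite sqr_sqrtr; last by apply: sumr_ge0 => j _; exact: sqr_ge0.
by apply: eq_bigr => j _; rewrite -real_normK ?num_real // pos_gap.
Qed.

Lemma enorm_ge0 (x : 'rV[R]_d) : 0 <= enorm x.
Proof. exact: sqrtr_ge0. Qed.

Lemma enorm_le_l1norm (x : 'rV[R]_d) : enorm x <= l1norm x.
Proof.
have l0 : 0 <= l1norm x by exact: sumr_ge0.
rewrite -[leRHS](ger0_norm l0) -sqrtr_sqr ler_wsqrtr // expr2 /l1norm mulr_suml.
apply: ler_sum => j _; rewrite -real_normK ?num_real // expr2 ler_wpM2l //.
by rewrite (bigD1 j) //= lerDl sumr_ge0.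
Qed.

Lemma l1norm_le_enorm (x : 'rV[R]_d) : l1norm x <= Num.sqrt d%:R * enorm x.
Proof.
have l0 : 0 <= l1norm x by exact: sumr_ge0.
rewrite -[leLHS](ger0_norm l0) -sqrtr_sqr -sqrtrM ?ler0n // ler_wsqrtr //.
rewrite expr2 /l1norm mulr_suml.
under eq_bigr => i _ do rewrite mulr_sumr.
(* [2 a b <= a ^ 2 + b ^ 2] for every pair of coordinates *)
apply: (@le_trans _ _ (\sum_(i < d) \sum_(j < d) (x 0 i ^+ 2 + x 0 j ^+ 2) / 2)).
  apply: ler_sum => i _; apply: ler_sum => j _.
  rewrite -(real_normK (num_real (x 0 i))) -(real_normK (num_real (x 0 j))).
  by have := sqr_ge0 (`|x 0 i| - `|x 0 j|); rewrite sqrrB; lra.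
under eq_bigr => i _ do rewrite -mulr_suml big_split /= sumr_const card_ord.
rewrite -mulr_suml big_split /= sumr_const card_ord -sumrMnl -mulr_natl.
by rewrite sumrMnl -mulr_natl; lra.
Qed.

(** This reduces a Wasserstein bound to one for each coupling, without an optimal one. Nonemptiness
    of [A] and nonnegativity of [g] keep both infima away from the default value of [inf]. *)
Lemma inf_image_le {X Y : Type} (A : set X) (B : set Y) (f : X -> R) (g : Y -> R)
    (a b : R) : A !=set0 -> 0 < a -> (forall y, B y -> 0 <= g y) ->
  (forall x, A x -> exists2 y, B y & g y <= a * f x + b) ->
  inf [set g y | y in B] <= a * inf [set f x | x in A] + b.
Proof.
move=> [x0 Ax0] a0 g0 H.
rewrite -lerBlDr mulrC -ler_pdivrMr //; apply: lb_le_inf.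
  by exists (f x0), x0.
move=> _ [x Ax <-]; have [y By gy] := H _ Ax.
rewrite ler_pdivrMr // mulrC lerBlDr; apply: le_trans gy.
apply: ge_inf; last by exists y.
by exists 0 => _ [y' By' <-]; exact: g0.
Qed.

Lemma wass_cost1 nu eta gam : couplings nu eta gam ->
  (\sum_z enorm (pos K h z.1 - pos K h z.2) `^ 1 * gam z) `^ 1^-1 =
  \sum_z enorm (pos K h z.1 - pos K h z.2) * gam z.
Proof.
move=> [[gam0 _] _ _]; rewrite invr1 powRr1; last first.
  by apply: sumr_ge0 => z _; rewrite mulr_ge0 ?powR_ge0.
by apply: eq_bigr => z _; rewrite powRr1 ?enorm_ge0.
Qed.

Lemma wass_cost2 nu eta gam : couplings nu eta gam ->
  (\sum_z enorm (pos K h z.1 - pos K h z.2) `^ 2 * gam z) `^ 2^-1 =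
  Num.sqrt (\sum_z grid_cost (fun r => (h * r%:R) ^+ 2) z * gam z).
Proof.
move=> [[gam0 _] _ _]; rewrite powR12_sqrt; last first.
  by apply: sumr_ge0 => z _; rewrite mulr_ge0 ?powR_ge0.
by congr Num.sqrt; apply: eq_bigr => z _; rewrite powR_mulrn ?enorm_ge0 // enorm_grid_cost.
Qed.

End Wasserstein.

(** * Box integrals of additive functions *)

Section BoxIntegral.
Context {R : realType}.
Implicit Types (a b : R) (f : R -> R).
Local Notation mu := (@lebesgue_measure R).

Lemma continuous_integrable a b f : continuous f ->
  mu.-integrable `[a, b] (EFin \o f).
Proof.
move=> fc; apply: continuous_compact_integrable; first exact: segment_compact.
exact: continuous_subspaceT.
Qed.

Lemma Rintegral_itv_cst a b c : a <= b -> Rintegral mu `[a, b] (fun=> c) = c * (b - a).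
Proof.
move=> ab; rewrite Rintegral_cst //= lebesgue_measure_itv /= lte_fin.
by case: ltgtP ab => //= -> _; rewrite subrr.
Qed.

(** Induction on [d], peeling off the first coordinate. The constant [c] makes the induction close:
    for fixed [t] it absorbs the term [g ord0 t]. *)
Lemma box_integral_additive a b d (c : R) (g : 'I_d -> R -> R) : a < b ->
  (forall j, continuous (g j)) ->
  box_integral a b (fun s : 'rV[R]_d => c + \sum_(j < d) g j (s 0 j)) =
  (b - a) ^+ d * (c + \sum_(j < d) Rintegral mu `[a, b] (g j) / (b - a)).
Proof.
move=> ab; have ba0 : b - a != 0 by rewrite subr_eq0 gt_eqF.
elim: d c g => [|d IH] c g gc /=.
  by rewrite !big_ord0 expr0 mul1r.
have split_first t : (fun s : 'rV[R]_d => c + \sum_(j < d.+1)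
      g j ((row_mx (const_mx t : 'rV[R]_1) s : 'rV[R]_(1 + d)) 0 j)) =
    (fun s => (c + g ord0 t) + \sum_(j < d) g (lift ord0 j) (s 0 j)).
  apply/funext => s; rewrite big_ord_recl addrA; congr (_ + _ + _).
    by congr (g _ _); rewrite mxE; case: splitP => // k _; rewrite mxE.
  apply: eq_bigr => j _; congr (g _ _); rewrite mxE.
  case: splitP => [k|k /= [jk]]; first by rewrite ord1.
  by congr (s _ _); apply/val_inj/esym.
under eq_Rintegral => t _ do
  rewrite split_first (IH _ (fun j => g (lift ord0 j))) // addrAC.
set S := \sum_(j < d) _.
rewrite RintegralZl //; last first.
  by apply: continuous_integrable => x; apply: cvgD; [exact: cvg_cst|exact: gc].
rewrite RintegralD //; [|exact/continuous_integrable/cst_continuous|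
  exact: continuous_integrable].
rewrite Rintegral_itv_cst ?ltW // big_ord_recl exprSr -mulrA; congr (_ * _).
by rewrite -/S mulrDr; field.
Qed.

End BoxIntegral.

(** * Cell averages and their increments in one dimension *)

Section CellMean.
Context {R : realType}.
Local Notation mu := (@lebesgue_measure R).

Definition cell_mean (h : R) (f : R -> R) (x : R) : R :=
  Rintegral mu `[- (h / 2), h / 2] (fun t => f (x + t)) / h.

(** Integrating one summand over the box gives its one-dimensional integral times [h ^+ d.-1], and
    the prefactor [h ^- d] turns this into a mean. *)
Lemma Vh_additive d (h : R) (V : 'rV[R]_d -> R) (Vc : 'I_d -> R -> R) (x : 'rV[R]_d) :
  0 < h -> (forall x, V x = \sum_j Vc j (x 0 j)) -> (forall j, continuous (Vc j)) ->
  Vh h V x = \sum_j cell_mean h (Vc j) (x 0 j).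
Proof.
move=> h0 VE Vcc; rewrite /Vh.
rewrite (_ : (fun s => _) = (fun s : 'rV[R]_d =>
   0 + \sum_j (fun t => Vc j (x 0 j + t)) (s 0 j))); last first.
  by apply/funext => s; rewrite VE add0r; apply: eq_bigr => j _; rewrite mxE.
rewrite (box_integral_additive 0 (g := fun j t => Vc j (x 0 j + t))); last 2 first.
- by lra.
- move=> j t; apply: continuous_comp; last exact: Vcc.
  by apply: cvgD; [exact: cvg_cst|exact: cvg_id].
have -> : h / 2 - - (h / 2) = h by field.
by rewrite add0r mulrA mulVf ?mul1r // expf_neq0 // gt_eqF.
Qed.

Variables (f f' : R -> R) (K kappa M : R).
Hypothesis df : forall x : R, is_derive x (1 : R) f (f' x).
Hypothesis f'_mono : forall x y, - K <= y -> y <= x -> x <= K ->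
  kappa * (x - y) <= f' x - f' y.
Hypothesis f'_bound : forall x, `|x| <= K -> `|f' x| <= M.

Lemma derive_continuous : continuous f.
Proof.
move=> x; apply: differentiable_continuous.
by apply/derivable1_diffP; have [] := df x.
Qed.

Lemma increment_bound (h x : R) : 0 <= h -> - K <= x -> x + h <= K ->
  `|f (x + h) - f x| <= M * h.
Proof.
move=> h0 xK xhK.
have [||c] := @MVT_segment R f f' x (x + h) _ (fun y _ => df y).
- by rewrite lerDl.
- exact/continuous_subspaceT/derive_continuous.
rewrite in_itv /= => /andP [c1 c2] ->; rewrite normrM addrAC subrr add0r (ger0_norm h0).
by rewrite ler_wpM2r // f'_bound // ler_norml; apply/andP; split; lra.
Qed.

(** The mean value theorem is applied to [f (u + (x - y)) - f u], so that one intermediate point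
    serves both increments and the two derivatives are compared at distance exactly [x - y]. *)
Lemma increment_mono (h x y : R) : 0 <= h -> - K <= y -> y <= x -> x + h <= K ->
  kappa * (x - y) * h <= (f (x + h) - f x) - (f (y + h) - f y).
Proof.
move=> h0 yK yx xhK.
pose g u := f (u + (x - y)) - f u.
have dg (u : R) : is_derive u (1 : R) g (f' (u + (x - y)) - f' u).
  rewrite -[f' (_ + _)]mulr1.
  have ds : is_derive u (1 : R) (shift (x - y)) 1 by exact: is_derive_shift.
  exact: (is_deriveB (is_derive1_comp (df _) ds) (df u)).
have [||c] := @MVT_segment R g _ y (y + h) _ (fun u _ => dg u).
- by rewrite lerDl.
- apply: continuous_subspaceT => u; apply: differentiable_continuous.
  by apply/derivable1_diffP; have [] := dg u.
rewrite in_itv /= => /andP [c1 c2] E.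
have -> : f (x + h) - f x - (f (y + h) - f y) = g (y + h) - g y.
  rewrite /g (_ : y + h + (x - y) = x + h); last by ring.
  by rewrite (_ : y + (x - y) = x); [ring|ring].
rewrite E (_ : y + h - y = h); last by ring.
rewrite ler_wpM2r //; apply: le_trans (f'_mono _ _ _); lra.
Qed.

Lemma cell_mean_increment (h x : R) :
  cell_mean h f (x + h) - cell_mean h f x =
  Rintegral mu `[- (h / 2), h / 2] (fun t => f (x + t + h) - f (x + t)) / h.
Proof.
rewrite /cell_mean -mulrBl; congr (_ / _).
have fc z : continuous (fun t => f (z + t)).
  move=> t; apply: continuous_comp; last exact: derive_continuous.
  by apply: cvgD; [exact: cvg_cst|exact: cvg_id].
rewrite -RintegralB //; [|exact: continuous_integrable..].
by apply: eq_Rintegral => t _; rewrite addrAC.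
Qed.

Lemma shifted_increment_continuous (h x : R) :
  continuous (fun t => f (x + t + h) - f (x + t)).
Proof.
move=> t; apply: cvgB.
  apply: (continuous_comp (f := fun t => x + t + h)); last exact: derive_continuous.
  by apply: cvgD; [apply: cvgD; [exact: cvg_cst|exact: cvg_id]|exact: cvg_cst].
apply: continuous_comp; last exact: derive_continuous.
by apply: cvgD; [exact: cvg_cst|exact: cvg_id].
Qed.

Lemma cell_mean_increment_bound (h x : R) : 0 < h ->
  - K <= x - h / 2 -> x + h + h / 2 <= K ->
  `|cell_mean h f (x + h) - cell_mean h f x| <= M * h.
Proof.
move=> h0 xK xhK; rewrite cell_mean_increment ler_norml.
(* Constants are rewritten as integrals over the cell, so that monotonicity of the integral carries
   over the pointwise bound. *)
have cE (c : R) : c * h = Rintegral mu `[- (h / 2), h / 2] (fun=> c).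
  by rewrite Rintegral_itv_cst; [field|lra].
have itvP t : `[- (h / 2), h / 2]%classic t -> `|f (x + t + h) - f (x + t)| <= M * h.
  by rewrite /= in_itv /= => /andP [t1 t2]; apply: increment_bound; lra.
rewrite ler_pdivlMr // ler_pdivrMr // (cE (- (M * h))) (cE (M * h)); apply/andP; split.
- apply: le_Rintegral => //; [exact/continuous_integrable/cst_continuous|
    exact/continuous_integrable/shifted_increment_continuous|].
  by move=> t /itvP; rewrite ler_norml => /andP [].
- apply: le_Rintegral => //; [exact/continuous_integrable/shifted_increment_continuous|
    exact/continuous_integrable/cst_continuous|].
  by move=> t /itvP; rewrite ler_norml => /andP [].
Qed.

Lemma cell_mean_increment_mono (h x y : R) : 0 < h ->
  - K <= y - h / 2 -> y <= x -> x + h + h / 2 <= K ->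
  kappa * (x - y) * h <=
  (cell_mean h f (x + h) - cell_mean h f x)
  - (cell_mean h f (y + h) - cell_mean h f y).
Proof.
move=> h0 yK yx xhK; rewrite !cell_mean_increment -mulrBl ler_pdivlMr //.
rewrite -RintegralB //; [|exact/continuous_integrable/shifted_increment_continuous..].
have cE (c : R) : c * h = Rintegral mu `[- (h / 2), h / 2] (fun=> c).
  by rewrite Rintegral_itv_cst; [field|lra].
rewrite (cE (kappa * (x - y) * h)); apply: le_Rintegral => //.
- exact/continuous_integrable/cst_continuous.
- by apply: continuous_integrable => t; apply: cvgB; exact: shifted_increment_continuous.
- move=> t; rewrite /= in_itv /= => /andP [t1 t2].
  rewrite (_ : x - y = x + t - (y + t)); last by ring.
  by apply: increment_mono; lra.
Qed.

End CellMean.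

(** * From the potential to its one-dimensional components *)

Section Potential.
Context {R : realType} {d : nat}.
Variables (K kappa : R) (V : 'rV[R]_d -> R) (Vc : 'I_d -> R -> R).
Hypothesis VE : forall x, V x = \sum_j Vc j (x 0 j).
Hypothesis V_C2 : C2 V.
Hypothesis V_lip : lipschitz_grad V.
Hypothesis V_convex : strongly_convex_on (cube K) kappa V.

Let axis (j : 'I_d) (s : R) : 'rV[R]_d := s *: basis_vec j.
(** The partial derivative of an additive [V] in direction [j] depends only on the coordinate [j],
    so its values on the axis through 0 determine it. *)
Let Vc' (j : 'I_d) (s : R) : R := grad V (axis j s) 0 j.

Lemma axisE j s l : axis j s 0 l = s * (l == j)%:R.
Proof. by rewrite !mxE eqxx. Qed.

Lemma sum_axis j s (F : 'I_d -> R -> R) : (forall l, l != j -> F l 0 = 0) ->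
  \sum_l F l (axis j s 0 l) = F j s.
Proof.
move=> F0; rewrite (bigD1 j) //= axisE eqxx mulr1 big1 ?addr0 // => l lj.
by rewrite axisE (negPf lj) mulr0 F0.
Qed.

Lemma axisB j s t : axis j s - axis j t = axis j (s - t).
Proof. by rewrite /axis scalerBl. Qed.

Lemma enorm_axis j s : enorm (axis j s) = `|s|.
Proof.
by rewrite /enorm (sum_axis _ (F := fun _ a => a ^+ 2)) ?sqrtr_sqr // => l _; rewrite expr0n.
Qed.

Lemma grad_axisB j x y :
  (grad V (axis j x) - grad V (axis j y)) 0 j = Vc' j x - Vc' j y.
Proof. by rewrite /Vc' [LHS]mxE [X in _ + X]mxE. Qed.

(** The components come with no regularity of their own. Along the axis the other components cancel
    in the difference quotient of [V], which thus equals that of [Vc j]. *)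
Lemma component_is_derive j (s : R) : is_derive s (1 : R) (Vc j) (Vc' j s).
Proof.
have [_ /(_ j) [dV _] _] := V_C2.
have E : (fun t : R => t^-1 *: (V (t *: basis_vec j + axis j s) - V (axis j s))) =
         (fun t : R => t^-1 *: (Vc j (t *: (1 : R) + s) - Vc j s)).
  apply/funext => t; congr (_ *: _); rewrite -scalerDl !VE -sumrB.
  rewrite (bigD1 j) //= -/(axis j _) !axisE eqxx !mulr1 big1 ?addr0.
    by rewrite /= [t *: 1]mulr1.
  by move=> l lj; rewrite !axisE (negPf lj) !mulr0 subrr.
split; first by have := dV (axis j s); rewrite /derivable E.
by rewrite /Vc' /grad mxE /derive E.
Qed.

(** Strong convexity is tested on two points of the same axis, both in the cube, and divided by
    [x - y]. *)
Lemma component_derive_mono j (x y : R) : - K <= y -> y <= x -> x <= K ->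
  kappa * (x - y) <= Vc' j x - Vc' j y.
Proof.
move=> yK yx xK; have [->|xy] := eqVneq x y; first by rewrite !subrr mulr0.
have K0 : 0 <= K by lra.
have cubeP s : - K <= s <= K -> cube K (axis j s).
  by move=> sK l; rewrite axisE; case: eqP; rewrite ?mulr1 ?mulr0 // => _; lra.
have := V_convex (cubeP x _) (cubeP y _).
rewrite axisB enorm_axis real_normK ?num_real //.
rewrite /dotr (sum_axis _ (F := fun l a => a * (grad V (axis j x) - grad V (axis j y)) 0 l));
  last by move=> l _; rewrite mul0r.
have xy0 : 0 < x - y by rewrite subr_gt0 lt_neqAle eq_sym xy.
rewrite expr2 mulrA [_ * (x - y)]mulrC ler_pM2l // grad_axisB.
by apply; lra.
Qed.

Lemma component_derive_bound : 0 <= K ->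
  exists2 M, 0 <= M & forall j x, `|x| <= K -> `|Vc' j x| <= M.
Proof.
move=> K0; have [L LP] := V_lip.
have S0 : 0 <= \sum_j `|Vc' j 0| by exact: sumr_ge0.
(* The absolute value is there because the sign of [L] is unknown; the sum over [j] gives one
   constant for all directions. *)
exists (`|L| * K + \sum_j `|Vc' j 0|) => [|j x xK].
  by rewrite addr_ge0 ?mulr_ge0.
rewrite -[Vc' j x](subrK (Vc' j 0)); apply: le_trans (ler_normD _ _) _.
apply: lerD; last by rewrite (bigD1 j) //= lerDl sumr_ge0.
apply: (@le_trans _ _ (enorm (grad V (axis j x) - grad V (axis j 0)))).
  rewrite -sqrtr_sqr ler_wsqrtr // (bigD1 j) //= grad_axisB lerDl.
  by apply: sumr_ge0 => l _; exact: sqr_ge0.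
apply: le_trans (LP _ _) _; rewrite axisB enorm_axis subr0.
apply: (@le_trans _ _ (`|L| * `|x|)); first by rewrite ler_wpM2r // ler_norm.
by rewrite ler_wpM2l.
Qed.

End Potential.

(** * One-dimensional rates under strong convexity *)

Section SiteRates.
Context {R : realType}.

Definition site_rate (N : nat) (h sigma : R) (v : nat -> R) (s : bool) (m : nat) : R :=
  if in_range N s m then
    sigma ^+ 2 / h ^+ 2 * expR (- (v (neighbor s m) - v m) / (2 * sigma ^+ 2))
  else 0.

Lemma site_rate_ge0 N h sigma v s m : 0 <= site_rate N h sigma v s m.
Proof.
by rewrite /site_rate; case: ifP => // _; rewrite mulr_ge0 ?expR_ge0 ?divr_ge0 ?sqr_ge0.
Qed.

(** The right side is [expR (- w) * (expR (w - u) - 1)]; the inequality [1 + x <= expR x] is used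
    once for each factor. *)
Lemma expR_decrement (u w : R) : u <= w ->
  (w - u) * (1 - w) <= expR (- u) - expR (- w).
Proof.
move=> uw; rewrite (_ : - u = - w + (w - u)); last by ring.
have E := expR_ge1Dx (w - u); have F := expR_ge1Dx (- w).
have W := expR_ge0 (- w); rewrite expRD.
have := ler_wpM2l W E.
have : 0 <= w - u by rewrite subr_ge0.
by move=> /ler_wpM2l/(_ _ _ F); lra.
Qed.

(** A lower bound for [1 - expR (- x)] that is linear up to a constant for bounded [x]; it compares
    the one-step error with [1 - rho]. *)
Lemma expR_opp_le (x : R) : 0 <= x -> x / (1 + x) <= 1 - expR (- x).
Proof.
move=> x0; have x1 : 0 < 1 + x by lra.
rewrite expRN; have : (expR x)^-1 <= (1 + x)^-1.
  by rewrite lef_pV2 ?posrE ?expR_gt0 ?expR_ge1Dx.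
have -> : x / (1 + x) = 1 - (1 + x)^-1 by field; rewrite gt_eqF.
by lra.
Qed.

Variables (N : nat) (h sigma K kappa M : R) (v : nat -> R).
Hypothesis h_gt0 : 0 < h.
Hypothesis sigma_gt0 : 0 < sigma.
Hypothesis kappa_gt0 : 0 < kappa.
Hypothesis M_ge0 : 0 <= M.
Hypothesis hN : h * N%:R = 2 * K.
Hypothesis v_bound : forall m, (m.+1 < N)%N -> `|v m.+1 - v m| <= M * h.
Hypothesis v_mono : forall l m, (l <= m)%N -> (m.+1 < N)%N ->
  kappa * (h * (m - l)%:R) * h <= (v m.+1 - v m) - (v l.+1 - v l).

Let q := site_rate N h sigma v.
(** [D * h] bounds the exponents that occur: a potential increment is at most [M * h], and convexity
    over a gap of at most [2 * K] adds at most [2 * K * kappa * h]. *)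
Let D : R := (M + 2 * K * kappa) / (2 * sigma ^+ 2).

Let s2_gt0 : 0 < 2 * sigma ^+ 2. Proof. by rewrite mulr_gt0 ?exprn_gt0. Qed.

Let a_gt0 : 0 < sigma ^+ 2 / h ^+ 2. Proof. by rewrite divr_gt0 ?exprn_gt0. Qed.

(** One of the two directions, hence half of the decay: [sigma ^+ 2 / h ^+ 2] times the exponent
    difference is exactly [kappa * r%:R / 2]. Only an upper bound on the slower rate [y] is assumed,
    so that [y = 0] at the boundary is covered. *)
Let half_excess (r : nat) (x y : R) : x <= M * h -> (r <= N)%N ->
  y <= sigma ^+ 2 / h ^+ 2 *
       expR (- (x + kappa * (h * r%:R) * h) / (2 * sigma ^+ 2)) ->
  kappa * r%:R / 2 * (1 - D * h) <=
  sigma ^+ 2 / h ^+ 2 * expR (- x / (2 * sigma ^+ 2)) - y.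
Proof.
move=> xM rN yle; have rK : h * r%:R <= 2 * K.
  by rewrite -hN ler_pM2l // ler_nat.
set w := (x + kappa * (h * r%:R) * h) / (2 * sigma ^+ 2) in yle.
pose u := x / (2 * sigma ^+ 2).
have h0 : h != 0 by rewrite gt_eqF.
have s0 : sigma != 0 by rewrite gt_eqF.
have wu : w - u = kappa * r%:R / 2 * (h ^+ 2 / sigma ^+ 2).
  by rewrite /w /u; field.
have w_le : w <= D * h.
  rewrite /w /D [leRHS]mulrAC ler_pM2r ?invr_gt0 // mulrDl lerD //.
  by rewrite ler_pM2r // mulrC ler_pM2r.
have kr : 0 <= kappa * r%:R / 2 by rewrite divr_ge0 ?mulr_ge0 // ltW.
have uw : u <= w.
  by rewrite -subr_ge0 wu mulr_ge0 // divr_ge0 ?sqr_ge0.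
have := ler_wpM2l (ltW a_gt0) (expR_decrement uw).
have -> : sigma ^+ 2 / h ^+ 2 * ((w - u) * (1 - w)) = kappa * r%:R / 2 * (1 - w).
  by rewrite wu; field; rewrite s0.
rewrite !mulNr -/w in yle *; rewrite -/u.
by have := ler_wpM2l kr w_le; lra.
Qed.

Lemma site_rate_contract (l m : nat) : (l < m < N)%N ->
  [/\ q true m <= q true l, q false l <= q false m
    & kappa * (m - l)%:R * (1 - D * h) <=
      q true l - q true m + (q false m - q false l)].
Proof.
move=> /andP [lm mN].
have [lN m0 mE rN l1N] : [/\ in_range N true l, in_range N false m, m.-1.+1 = m,
    (m - l <= N)%N & (l.+1 < N)%N] by rewrite /=; split; lia.
have pred_sub : (0 < l)%N -> (m.-1 - l.-1 = m - l)%N /\ (l.-1 <= m.-1)%N by lia.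
have kr (r : nat) : 0 <= kappa * (h * r%:R) * h.
  by rewrite !mulr_ge0 // ltW.
have up : q true m <= sigma ^+ 2 / h ^+ 2 * expR (-
    (v l.+1 - v l + kappa * (h * (m - l)%:R) * h) / (2 * sigma ^+ 2)).
  rewrite /q /site_rate; case: ifP => [mN1|_]; last by rewrite mulr_ge0 ?expR_ge0 ?ltW.
  rewrite ler_pM2l // ler_expR ler_pM2r ?invr_gt0 // lerN2 /=.
  by have := v_mono (ltnW lm) mN1; lra.
(* Downward increments are upward ones read from the predecessors, so [v_mono] is used at [l.-1] and
   [m.-1]; at [l = 0] the rate is 0. *)
have dn : q false l <= sigma ^+ 2 / h ^+ 2 * expR (-
    (v m.-1 - v m + kappa * (h * (m - l)%:R) * h) / (2 * sigma ^+ 2)).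
  rewrite /q /site_rate; case: ifP => [/= l0|_]; last by rewrite mulr_ge0 ?expR_ge0 ?ltW.
  rewrite ler_pM2l // ler_expR ler_pM2r ?invr_gt0 // lerN2 /=.
  have [ml lm1] := pred_sub l0.
  by have := v_mono lm1; rewrite mE prednK // ml => /(_ mN); lra.
have upE : q true l = sigma ^+ 2 / h ^+ 2 * expR (- (v l.+1 - v l) / (2 * sigma ^+ 2)).
  by rewrite /q /site_rate lN.
have dnE : q false m = sigma ^+ 2 / h ^+ 2 * expR (- (v m.-1 - v m) / (2 * sigma ^+ 2)).
  by rewrite /q /site_rate m0.
split.
- apply: le_trans up _; rewrite upE ler_pM2l // ler_expR ler_pM2r ?invr_gt0 // lerN2.
  by rewrite lerDl.
- apply: le_trans dn _; rewrite dnE ler_pM2l // ler_expR ler_pM2r ?invr_gt0 // lerN2.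
  by rewrite lerDl.
have vl : v l.+1 - v l <= M * h.
  exact: le_trans (ler_norm _) (v_bound _).
have vm : v m.-1 - v m <= M * h.
  have := @v_bound m.-1; rewrite mE => /(_ mN); apply: le_trans.
  by rewrite distrC ler_norm.
have := half_excess vl rN up; have := half_excess vm rN dn.
by rewrite -upE -dnE; lra.
Qed.

(** With [r = m - l], the squared gap drops by [h ^+ 2 * (2 * r - 1)]. Against an excess
    [kappa * r * (1 - D * h)] the main term is [2 * kappa * (h * r) ^+ 2]. The [- 1] and the [D * h]
    cause the two error terms, bounded through [h * r <= 2 * K]. *)
Lemma site_rate_drift (l m : nat) : (l < m < N)%N ->
  (q true l - q true m + (q false m - q false l)) *
    ((h * (m - l).-1%:R) ^+ 2 - (h * (m - l)%:R) ^+ 2)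
  <= (2 * K * kappa + 8 * K ^+ 2 * kappa * D) * h - 2 * kappa * (h * (m - l)%:R) ^+ 2.
Proof.
move=> lmN; have [rN r_gt0] : (m - l <= N)%N /\ (0 < m - l)%N by lia.
have [_ _] := site_rate_contract lmN.
set S := (X in _ <= X) => HS; move: HS rN r_gt0; case: (m - l)%N => // r HS rN _ /=.
have rK : h * r.+1%:R <= 2 * K by rewrite -hN ler_pM2l // ler_nat.
have r0 : (0 : R) <= r%:R by [].
have D0 : 0 <= D.
  have K0 : 0 <= 2 * K by rewrite -hN mulr_ge0 ?ler0n ?(ltW h_gt0).
  by apply: divr_ge0 (ltW s2_gt0); rewrite addr_ge0 // mulr_ge0 // ltW.
rewrite -natr1 in HS rK *.
set x := r%:R in HS rK r0 *.
have h2 : 0 <= h ^+ 2 * (2 * x + 1) by rewrite mulr_ge0 ?sqr_ge0 //; lra.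
have H1 := ler_wpM2l h2 HS.
have H2 : (h * (x + 1)) * (kappa * h) <= 2 * K * (kappa * h).
  by rewrite ler_wpM2r // mulr_ge0 // ltW.
have y0 : 0 <= h * (x + 1) by rewrite mulr_ge0 ?ltW //; lra.
have H3 : (h * (x + 1)) ^+ 2 <= (2 * K) ^+ 2.
  by apply: lerXn2r; rewrite ?nnegrE //; exact: le_trans rK.
have kDh : 0 <= 2 * kappa * D * h.
  by apply: mulr_ge0 (ltW h_gt0); apply: mulr_ge0 D0; rewrite mulr_ge0 // ltW.
have H4 := ler_wpM2l kDh H3.
have H5 : 0 <= h * (x + 1) * (2 * kappa * D * h) * h.
  by apply: mulr_ge0 (ltW h_gt0); exact: mulr_ge0.
by rewrite -/S; lra.
Qed.

End SiteRates.

(** * From neighbouring sites to arbitrary gaps *)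

Section StepToInterval.
Context {R : realType} (N : nat).

Lemma telescope_ge (F : nat -> R) (c : R) l m :
  (forall a, (a.+1 < N)%N -> c <= F a.+1 - F a) ->
  (l <= m < N)%N -> c * (m - l)%:R <= F m - F l.
Proof.
move=> Fc /andP [lm mN]; rewrite -(subnKC lm) in mN *; rewrite addKn.
elim: (m - l)%N mN => [|r IH] mN; first by rewrite mulr0 addn0 subrr.
rewrite addnS in mN *; have := IH (ltnW mN); have := Fc _ mN.
by rewrite -natr1; lra.
Qed.

Lemma contract_from_steps (up dn : nat -> R) (c h : R) : 0 < h ->
  (forall a, (a.+1 < N)%N ->
     [/\ up a.+1 <= up a, dn a <= dn a.+1
       & c <= up a - up a.+1 + (dn a.+1 - dn a)]) ->
  forall l m, (l < m < N)%N ->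
  [/\ up m <= up l, dn l <= dn m
    & (up l - up m + (dn m - dn l)) * (h * (m - l).-1%:R - h * (m - l)%:R)
      <= 0 - c * (h * (m - l)%:R)].
Proof.
move=> h_gt0 steps l m /andP [lm mN].
have lmN : (l <= m < N)%N by rewrite (ltnW lm).
(* Monotonicity is the telescoping bound with increment 0. *)
have Hup : 0 * (m - l)%:R <= - up m - - up l.
  by apply: telescope_ge (fun a => - up a) _ _ _ _ lmN => a /steps [? _ _]; lra.
have Hdn : 0 * (m - l)%:R <= dn m - dn l.
  by apply: telescope_ge lmN => a /steps [_ ? _]; lra.
have Hc : c * (m - l)%:R <= dn m - up m - (dn l - up l).
  by apply: telescope_ge (fun a => dn a - up a) _ _ _ _ lmN => a /steps [_ _ ?]; lra.
split; [by lra|by lra|].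
move: Hc; case: (m - l)%N (subn_gt0 l m) => [|r _]; first by rewrite lm.
by rewrite -natr1 /= => /(ler_wpM2r (ltW h_gt0)); lra.
Qed.

End StepToInterval.

(** * Rates of the chain and contraction of its law *)

Section Assembly.
Context {R : realType} {d : nat}.
Variables (K sigma : R) (V : 'rV[R]_d -> R) (Vc : 'I_d -> R -> R).
Hypothesis hd : (1 <= d)%N.
Hypothesis K_gt0 : 0 < K.
Hypothesis sigma_gt0 : 0 < sigma.
Hypothesis VE : forall x, V x = \sum_j Vc j (x 0 j).
Hypothesis Vc_cont : forall j, continuous (Vc j).

Definition cell_potential (h : R) (j : 'I_d) (m : nat) : R :=
  cell_mean h (Vc j) (- K + h * m.+1%:R - h / 2).

Lemma cell_potentialS h j m :
  cell_potential h j m.+1 = cell_mean h (Vc j) (- K + h * m.+1%:R - h / 2 + h).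
Proof. by congr (cell_mean _ _ _); rewrite -[m.+2%:R]natr1; ring. Qed.

Variables (h : R) (N : nat).
Hypothesis h_gt0 : 0 < h.
Hypothesis hN : 2 * K / h = N%:R.

Let v := cell_potential h.
Let q (j : 'I_d) := site_rate N h sigma (v j).

Lemma rate_site (i : grid d N) (j : 'I_d) (s : bool) :
  rate K h sigma V i (j, s) = q j s (i j).
Proof.
rewrite /q /site_rate /rate -(move_to_in_range K h_gt0).
case e: (move_to K h i (j, s)) => [k|//].
case/eqP/(move_toP _ h_gt0): e => _ kj kl.
have -> // : Vh h V (pos K h k) - Vh h V (pos K h i) =
  v j (neighbor s (i j)) - v j (i j).
rewrite !(Vh_additive _ h_gt0 VE Vc_cont) -sumrB (bigD1 j) //= big1 ?addr0.
  by rewrite !mxE kj.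
by move=> l lj; rewrite !mxE kl // subrr.
Qed.

Lemma rate_siteE :
  rate K h sigma V = (fun (i : grid d N) (g : move d) => q g.1 g.2 (i g.1)).
Proof. by apply/funext => i; apply/funext => -[j s]; rewrite rate_site. Qed.

(** The factor [1 - lam * tau] is relaxed to [expR (- (lam * tau))], which is positive and has the
    required exponential as its powers. The condition on [B] absorbs the one-step error. *)
Lemma law_cost_contraction (g : nat -> R) (lam e B : R) :
  g 0%N = 0 -> 0 <= e -> (forall r, 0 <= g r) ->
  (forall j l m, (l < m < N)%N ->
     [/\ q j true m <= q j true l, q j false l <= q j false m
       & (q j true l - q j true m + (q j false m - q j false l)) *
         (g (m - l).-1 - g (m - l)%N) <= e - lam * g (m - l)%N]) ->
  tau N K h sigma V * (d%:R * e) <= (1 - expR (- (lam * tau N K h sigma V))) * B ->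
  forall (nu eta : grid d N -> R) gam n, couplings nu eta gam ->
  exists2 gam', couplings (law K h sigma V nu n) (law K h sigma V eta n) gam'
    & \sum_z grid_cost g z * gam' z <=
      expR (- (lam * n%:R * tau N K h sigma V)) * (\sum_z grid_cost g z * gam z)
      + (1 - expR (- (lam * n%:R * tau N K h sigma V))) * B.
Proof.
move=> g0 e0 gp qP tB nu eta gam n gamP.
have -> : - (lam * n%:R * tau N K h sigma V) = n%:R * - (lam * tau N K h sigma V).
  by ring.
rewrite expRM_natl; apply: law_coupling gamP => // z.
rewrite rate_siteE; have q_ge0 j s m : 0 <= q j s m by exact: site_rate_ge0.
have q_out j s m : ~~ in_range N s m -> q j s m = 0.
  by move=> r; rewrite /q /site_rate (negPf r).
have t_ge0 : 0 <= tau N K h sigma V by exact: tau_ge0.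
apply: le_trans (grid_cost_contraction K h_gt0 q_ge0 q_out t_ge0 g0 e0 qP z) _.
apply: lerD tB; rewrite ler_wpM2r ?sumr_ge0 //.
exact: expR_ge1Dx.
Qed.

(** A move in direction [j] leaves the rates of the other directions unchanged, so the sum of
    positive parts vanishes. *)
Lemma kappa_pm_site (i k : grid d N) j s : move_to K h i (j, s) = Some k ->
  kappa_pm K h sigma V s i j = q j s (i j) - q j s (k j).
Proof.
move=> e; rewrite /kappa_pm e !rate_site big1 ?subr0 //.
case/eqP/(move_toP _ h_gt0): e => _ _ kl [l s'] gl.
have lj : l != j by apply: contraNneq gl => ->; case: s'; rewrite !inE eqxx ?orbT.
by rewrite !rate_site kl // subrr maxxx.
Qed.

(** * Contraction in the graph distance *)

Section PositiveCurvature.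
Hypothesis kp_gt0 : forall (j : 'I_d) (i : grid d N),
  move_to K h i (j, true) -> 0 < kappa_pm K h sigma V true i j.
Hypothesis km_gt0 : forall (j : 'I_d) (i : grid d N),
  move_to K h i (j, false) -> 0 < kappa_pm K h sigma V false i j.

Let k1 : R := kappa1 N K h sigma V.

Lemma site_step j a : (a.+1 < N)%N ->
  [/\ q j true a.+1 <= q j true a, q j false a <= q j false a.+1
    & k1 <= q j true a - q j true a.+1 + (q j false a.+1 - q j false a)].
Proof.
move=> aN; pose i : grid d N := [ffun=> Ordinal (ltnW aN)].
(* The rates in direction [j] see only the coordinate [j], so the grid point with all indices equal
   to [a] represents every point with [i j = a]. *)
have ij : i j = a :> nat by rewrite ffunE.
have r : in_range N true (i j) by rewrite ij.
have [k e] := move_to_some K h_gt0 r.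
have kj : k j = a.+1 :> nat by case/eqP/(move_toP _ h_gt0): (e) => _ ->; rewrite ij.
have e' := move_to_reverse h_gt0 e.
have := kp_gt0 (j := j) (i := i); have := km_gt0 (j := j) (i := k).
rewrite (kappa_pm_site e) (kappa_pm_site e') e e' /= ij kj => /(_ isT) m0 /(_ isT) p0.
rewrite !subr_gt0 in m0 p0; split; [exact: ltW|exact: ltW|].
apply: ge_inf; last first.
  by exists j, i, k; split; rewrite // (kappa_pm_site e) (kappa_pm_site e') /= ij kj.
(* Positivity of both curvatures bounds the set defining [kappa1] below, so its infimum is at most
   each element. *)
exists 0 => _ [j' [i' [k' [e1 ->]]]].
by apply/ltW/addr_gt0; [apply: kp_gt0; rewrite e1|
  apply: km_gt0; rewrite (move_to_reverse h_gt0 e1)].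
Qed.

Lemma site_contract j l m : (l < m < N)%N ->
  [/\ q j true m <= q j true l, q j false l <= q j false m
    & (q j true l - q j true m + (q j false m - q j false l)) *
      (h * (m - l).-1%:R - h * (m - l)%:R) <= 0 - k1 * (h * (m - l)%:R)].
Proof. exact: contract_from_steps h_gt0 (@site_step j) _ _. Qed.

Lemma wass_d1_contraction (nu eta : grid d N -> R) n : is_prob nu -> is_prob eta ->
  wass_d1 K h (law K h sigma V nu n) (law K h sigma V eta n)
    <= expR (- (k1 * n%:R * tau N K h sigma V)) * wass_d1 K h nu eta
  /\ wass K h 1 (law K h sigma V nu n) (law K h sigma V eta n)
    <= Num.sqrt d%:R * expR (- (k1 * n%:R * tau N K h sigma V)) * wass K h 1 nu eta.
Proof.
move=> hnu heta; have nonempty := couplings_nonempty hnu heta.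
have step gam : couplings nu eta gam -> exists2 gam',
    couplings (law K h sigma V nu n) (law K h sigma V eta n) gam'
    & \sum_z l1norm (pos K h z.1 - pos K h z.2) * gam' z <=
      expR (- (k1 * n%:R * tau N K h sigma V)) *
      (\sum_z l1norm (pos K h z.1 - pos K h z.2) * gam z).
  move=> gamP.
  (* For the linear cost the drift is exact, so there is no error term. *)
  have [||||gam' gam'P H] := law_cost_contraction
    (g := fun r => h * r%:R) (lam := k1) (e := 0) (B := 0) _ _ _ site_contract _ n gamP.
  - by rewrite mulr0.
  - by [].
  - by move=> r; rewrite mulr_ge0 // ltW.
  - by rewrite !mulr0.
  exists gam' => //; rewrite mulr0 addr0 in H.
  under eq_bigr => z _ do rewrite l1norm_grid_cost //.
  by under [X in _ <= _ * X]eq_bigr => z _ do rewrite l1norm_grid_cost //.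
have l1_ge0 (z : grid d N * grid d N) : 0 <= l1norm (pos K h z.1 - pos K h z.2) by exact: sumr_ge0.
split.
  rewrite -[leRHS]addr0; apply: inf_image_le => //; first exact: expR_gt0.
    by move=> gam [[gam0 _] _ _]; apply: sumr_ge0 => z _; rewrite mulr_ge0.
  by move=> gam /step [gam' gam'P H]; exists gam'; rewrite ?addr0.
rewrite -[leRHS]addr0; apply: inf_image_le => //.
- by rewrite mulr_gt0 ?expR_gt0 // sqrtr_gt0 ltr0n.
- by move=> gam _; exact: powR_ge0.
move=> gam gamP; have [gam' gam'P H] := step _ gamP; exists gam' => //.
rewrite (wass_cost1 _ _ gamP) (wass_cost1 _ _ gam'P) addr0.
have [[[gam0 _] _ _] [[gam'0 _] _ _]] := (gamP, gam'P).
(* Passing to the graph distance costs nothing after the evolution and a factor [Num.sqrt d%:R]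
   before it. *)
apply: (@le_trans _ _ (\sum_z l1norm (pos K h z.1 - pos K h z.2) * gam' z)).
  by apply: ler_sum => z _; rewrite ler_wpM2r // enorm_le_l1norm.
apply: le_trans H _; rewrite [_ * expR _]mulrC -(mulrA (expR _)) ler_wpM2l ?expR_ge0 // mulr_sumr.
by apply: ler_sum => z _; rewrite mulrA ler_wpM2r // l1norm_le_enorm.
Qed.

End PositiveCurvature.

(** * Contraction in the quadratic Wasserstein distance *)

Section StrongConvexity.
Variables (kappa M : R) (Vc' : 'I_d -> R -> R).
Hypothesis kappa_gt0 : 0 < kappa.
Hypothesis M_ge0 : 0 <= M.
Hypothesis dVc : forall j (x : R), is_derive x (1 : R) (Vc j) (Vc' j x).
Hypothesis Vc'_mono : forall j x y, - K <= y -> y <= x -> x <= K ->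
  kappa * (x - y) <= Vc' j x - Vc' j y.
Hypothesis Vc'_bound : forall j x, `|x| <= K -> `|Vc' j x| <= M.

Let hN2K : h * N%:R = 2 * K.
Proof. by rewrite -hN mulrC divfK // gt_eqF. Qed.

Let top m : (m.+1 < N)%N -> h * m%:R + 2 * h <= 2 * K.
Proof.
move=> mN; rewrite -hN2K [2 * h]mulrC -mulrDr -natrD ler_pM2l // ler_nat.
by rewrite addn2.
Qed.

Let gridS (m : nat) : h * m.+1%:R = h * m%:R + h.
Proof. by rewrite -natr1 mulrDr mulr1. Qed.

Lemma cell_potential_bound j m : (m.+1 < N)%N ->
  `|v j m.+1 - v j m| <= M * h.
Proof.
move=> mN; rewrite /v cell_potentialS.
have m0 : 0 <= h * m%:R by rewrite mulr_ge0 // ltW.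
have mt := top mN.
by apply: (cell_mean_increment_bound (dVc j) (Vc'_bound j) h_gt0);
  rewrite gridS; lra.
Qed.

Lemma cell_potential_mono j l m : (l <= m)%N -> (m.+1 < N)%N ->
  kappa * (h * (m - l)%:R) * h <= (v j m.+1 - v j m) - (v j l.+1 - v j l).
Proof.
move=> lm mN; rewrite /v !cell_potentialS natrB //.
have l0 : 0 <= h * l%:R by rewrite mulr_ge0 // ltW.
have hlm : h * l%:R <= h * m%:R by rewrite ler_pM2l // ler_nat.
have mt := top mN.
set x := - K + h * m.+1%:R - h / 2; set y := - K + h * l.+1%:R - h / 2.
have -> : h * (m%:R - l%:R) = x - y by rewrite /x /y !gridS; ring.
by apply: (cell_mean_increment_mono (dVc j) (Vc'_mono j) h_gt0);
  rewrite /x /y !gridS; lra.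
Qed.

(** A lower bound, free of [h], for a rate between two neighbouring cells: there [h <= 2 * K], and
    the potential increment is at most [M * h]. *)
Definition rate_floor : R :=
  sigma ^+ 2 / (2 * K) ^+ 2 * expR (- (M * (2 * K) / (2 * sigma ^+ 2))).

Lemma rate_floor_gt0 : 0 < rate_floor.
Proof. by rewrite mulr_gt0 ?expR_gt0 // divr_gt0 // exprn_gt0 // mulr_gt0. Qed.

(** A single rate, upward from the lowest corner, bounds [calT] below. With at most one cell per
    direction there are no moves, and [tau] is 0 by the convention on inverses. *)
Lemma tau_le : tau N K h sigma V <= (2 * rate_floor)^-1.
Proof.
have f0 := rate_floor_gt0; have f2 : 0 < 2 * rate_floor by rewrite mulr_gt0.
rewrite /tau; have [N1|N1] := leqP N 1.
  rewrite (_ : calT _ _ _ _ _ = 0) ?invr0 ?invr_ge0 ?(ltW f2) //.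
  have max00 : Num.max (0 : R) 0 = 0 by exact: maxxx.
  rewrite /calT big1_idem ?mulr0 // => i _; apply: big1 => -[j s] _.
  rewrite rate_site /q /site_rate; case: ifP => //.
  by have := ltn_ord (i j); case: s => /=; lia.
have N0 : (0 < N)%N by apply: ltnW.
pose i : grid d N := [ffun=> Ordinal N0]; pose j : 'I_d := Ordinal hd.
have h2K : h <= 2 * K by rewrite -hN2K ler_peMr ?ler1n // ltW.
have rf : rate_floor <= rate K h sigma V i (j, true).
  rewrite rate_site ffunE /q /site_rate /= N1 /rate_floor.
  have s0 : 0 <= sigma ^+ 2 by exact: sqr_ge0.
  apply: ler_pM; rewrite ?expR_ge0 ?divr_ge0 ?sqr_ge0 //.
    rewrite ler_wpM2l // lef_pV2 ?posrE ?exprn_gt0 ?mulr_gt0 //.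
    by apply: lerXn2r; rewrite ?nnegrE // ltW // mulr_gt0.
  rewrite ler_expR -mulNr ler_pM2r ?invr_gt0 ?mulr_gt0 ?exprn_gt0 // lerN2.
  apply: le_trans (ler_norm _) _; apply: le_trans (cell_potential_bound j N1) _.
  by rewrite ler_wpM2l.
rewrite lef_pV2 ?posrE //; last apply: lt_le_trans f2 _;
  apply: le_trans (calT_ge K h sigma V i); rewrite ler_pM2l //;
  rewrite (bigD1 (j, true)) //=; apply: le_trans rf _;
  by rewrite lerDl sumr_ge0 // => g _; exact: rate_ge0.
Qed.

Definition sq_error : R :=
  2 * K * kappa + 8 * K ^+ 2 * kappa * ((M + 2 * K * kappa) / (2 * sigma ^+ 2)).

Lemma sq_error_ge0 : 0 <= sq_error.
Proof.
have k0 := ltW kappa_gt0; have K0 := ltW K_gt0.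
have Kk : 0 <= 2 * K * kappa by rewrite !mulr_ge0.
apply: addr_ge0 => //; apply: mulr_ge0; first by rewrite !mulr_ge0 ?sqr_ge0.
by apply: divr_ge0; [rewrite addr_ge0|rewrite mulr_ge0 ?sqr_ge0].
Qed.

(** Chosen to balance the step error [tau * d * sq_error * h] against [1 - expR (- x)] for
    [x = 2 * kappa * tau]: this difference is at least [x / (1 + x)], and [x <= kappa / rate_floor]
    by [tau_le]. *)
Definition wass2_const : R :=
  d%:R * sq_error * (1 + kappa / rate_floor) / (2 * kappa).

Lemma wass2_contraction (nu eta : grid d N -> R) n : is_prob nu -> is_prob eta ->
  wass K h 2 (law K h sigma V nu n) (law K h sigma V eta n)
    <= expR (- (kappa * n%:R * tau N K h sigma V)) * wass K h 2 nu eta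
       + Num.sqrt wass2_const * Num.sqrt h.
Proof.
move=> hnu heta; have h0 := ltW h_gt0.
have f0 := rate_floor_gt0; have E0 := sq_error_ge0.
have t0 : 0 <= tau N K h sigma V by exact: tau_ge0.
have kf : 0 <= kappa / rate_floor by rewrite divr_ge0 // ltW.
have C0 : 0 <= wass2_const.
  apply: divr_ge0; last by rewrite mulr_ge0 ?(ltW kappa_gt0).
  by apply: mulr_ge0; [exact: mulr_ge0|exact: addr_ge0].
apply: inf_image_le; [exact: couplings_nonempty|exact: expR_gt0|
  by move=> gam _; exact: powR_ge0|].
move=> gam gamP.
have contract j l m : (l < m < N)%N ->
    [/\ q j true m <= q j true l, q j false l <= q j false m
      & (q j true l - q j true m + (q j false m - q j false l)) *
        ((h * (m - l).-1%:R) ^+ 2 - (h * (m - l)%:R) ^+ 2) <=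
        sq_error * h - 2 * kappa * (h * (m - l)%:R) ^+ 2].
  move=> lmN.
  have [Hu Hd _] := site_rate_contract h_gt0 sigma_gt0 kappa_gt0 M_ge0 hN2K
    (cell_potential_bound j) (@cell_potential_mono j) lmN.
  split=> //; exact: (site_rate_drift h_gt0 sigma_gt0 kappa_gt0 M_ge0 hN2K
    (cell_potential_bound j) (@cell_potential_mono j) lmN).
(* The squared distance decays at rate [2 * kappa]; the square root taken below restores [kappa] and
   turns an error of order [h] into one of order [Num.sqrt h]. *)
have [||||gam' gam'P H] := law_cost_contraction
  (g := fun r => (h * r%:R) ^+ 2) (lam := 2 * kappa) (e := sq_error * h)
  (B := wass2_const * h) _ _ _ contract _ n gamP.
- by rewrite mulr0 expr0n.
- exact: mulr_ge0.
- by move=> r; exact: sqr_ge0.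
- set t := tau N K h sigma V in t0 *.
  have x0 : 0 <= 2 * kappa * t by rewrite !mulr_ge0 // ltW.
  have xA : 2 * kappa * t <= kappa / rate_floor.
    apply: (@le_trans _ _ (2 * kappa * (2 * rate_floor)^-1)).
      by rewrite ler_wpM2l ?tau_le // mulr_ge0 // ltW.
    by rewrite le_eqVlt; apply/orP; left; apply/eqP; field; rewrite gt_eqF.
  have -> : t * (d%:R * (sq_error * h)) =
      2 * kappa * t / (1 + kappa / rate_floor) * (wass2_const * h).
    rewrite /wass2_const; field; rewrite (gt_eqF kappa_gt0) (gt_eqF f0) /=.
    by rewrite gt_eqF // addr_gt0.
  apply: ler_wpM2r; first exact: mulr_ge0.
  apply: le_trans _ (expR_opp_le x0).
  rewrite ler_wpM2l // lef_pV2 ?posrE; first by rewrite lerD2l.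
  - by rewrite ltr_pwDl.
  - by rewrite ltr_pwDl.
exists gam' => //; rewrite (wass_cost2 _ h_gt0 gamP) (wass_cost2 _ h_gt0 gam'P).
have [[gam0 _] _ _] := gamP.
set F := \sum_z grid_cost _ z * gam z in H *.
have F0 : 0 <= F.
  by apply: sumr_ge0 => z _; rewrite mulr_ge0 // sumr_ge0 // => j _; exact: sqr_ge0.
set r := expR (- (kappa * n%:R * _)).
have r0 : 0 <= r by exact: expR_ge0.
have r2 : expR (- (2 * kappa * n%:R * tau N K h sigma V)) = r ^+ 2.
  by rewrite /r -expRM_natl; congr expR; ring.
rewrite r2 in H; rewrite -[leRHS]ger0_norm; last first.
  by rewrite addr_ge0 ?mulr_ge0 ?sqrtr_ge0.
rewrite -sqrtr_sqr ler_wsqrtr //; apply: le_trans H _.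
(* Expanding the square of the target leaves two nonnegative surpluses: the cross term [X0] and the
   part [Y0] subtracted from the error. *)
rewrite sqrrD !exprMn !sqr_sqrtr //.
have X0 : 0 <= r * Num.sqrt F * (Num.sqrt wass2_const * Num.sqrt h).
  by rewrite !mulr_ge0 ?sqrtr_ge0.
have Y0 : 0 <= r ^+ 2 * (wass2_const * h).
  by apply: mulr_ge0; [exact: sqr_ge0|exact: mulr_ge0].
by lra.
Qed.

End StrongConvexity.

End Assembly.

Theorem theorem13 (R : realType) (d : nat) (hd : (1 <= d)%N)
    (K sigma kappa : R) (hK : 0 < K) (hsigma : 0 < sigma) (hkappa : 0 < kappa)
    (V : 'rV[R]_d -> R)
    (V_C2 : C2 V) (V_additive : additive_form V) (V_lip : lipschitz_grad V)
    (V_convex : strongly_convex_on (cube K) kappa V) :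
  (exists C : R,
     forall (h : R) (N : nat), 0 < h -> 2 * K / h = N%:R ->
     forall nu eta : grid d N -> R, is_prob nu -> is_prob eta ->
     forall n : nat,
       wass K h 2 (law K h sigma V nu n) (law K h sigma V eta n)
       <= expR (- (kappa * n%:R * tau N K h sigma V)) * wass K h 2 nu eta
          + C * Num.sqrt h)
  /\
  (forall (h : R) (N : nat), 0 < h -> 2 * K / h = N%:R ->
     (forall (j : 'I_d) (i : grid d N),
        move_to K h i (j, true) -> 0 < kappa_pm K h sigma V true i j) ->
     (forall (j : 'I_d) (i : grid d N),
        move_to K h i (j, false) -> 0 < kappa_pm K h sigma V false i j) ->
     forall nu eta : grid d N -> R, is_prob nu -> is_prob eta ->
     forall n : nat,
       wass_d1 K h (law K h sigma V nu n) (law K h sigma V eta n)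
       <= expR (- (kappa1 N K h sigma V * n%:R * tau N K h sigma V))
          * wass_d1 K h nu eta
       /\
       wass K h 1 (law K h sigma V nu n) (law K h sigma V eta n)
       <= Num.sqrt d%:R
          * expR (- (kappa1 N K h sigma V * n%:R * tau N K h sigma V))
          * wass K h 1 nu eta).
Proof.
have [Vc VE] := V_additive.
have dVc := component_is_derive VE V_C2.
have Vc_cont j : continuous (Vc j) := derive_continuous (dVc j).
split; last first.
  move=> h N h0 hN kp km nu eta hnu heta n.
  exact: (wass_d1_contraction hd VE Vc_cont h0 kp km n hnu heta).
have [M M0 Vc'_bound] := component_derive_bound V_lip (ltW hK).
(* [M] depends only on [V] and [K], so the constant is fixed before [h], [n] and the two
   measures. *)
exists (Num.sqrt (wass2_const (d := d) K sigma kappa M)) => h N h0 hN nu eta hnu heta n.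
exact: (wass2_contraction hd hK hsigma VE Vc_cont h0 hN hkappa M0 dVc
  (component_derive_mono V_convex) Vc'_bound n hnu heta).
Qed.
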